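(* Let $D$ be a finite connected $k$-scheme. The group scheme $\Sigma_D$ is local. In fact, let $\mathfrak m$ stand for the maximal ideal of the local ring $\mathcal O(D)$ and let $h\ge 1$ be such that $\mathfrak m^{[p^h]}=0$ while $\mathfrak m^{[p^{h-1}]}\neq0$. Then $\Sigma_D$ is annihilated by $\mathrm{Fr}^h$ but not by $\mathrm{Fr}^{h-1}$, i.e. $\Sigma_D$ is of height $h$.
   Context: $k$ is an algebraically closed field of characteristic $p>0$, $\mathbf{pt}=\operatorname{Spec}k$, and ''group scheme'' means affine group scheme over $k$. A group scheme is local if it has only one closed point. $\mathfrak a^{[p^h]}$ denotes the ideal generated by the $p^h$-th powers of the elements of $\mathfrak a$. A group scheme $G$ is annihilated by $\mathrm{Fr}^h$ if its $h$-th iterated Frobenius morphism is trivial, i.e. $f^{p^h}=0$ for every $f$ in the augmentation ideal of $\mathcal O(G)$. Let $s:\mathbf{pt}\to D$ be the unique point. The category $\mathcal S_D$ has as objects pairs $(V,\beta)$ with $V$ a finite dimensional $k$-vector space and $\beta$ an $\mathcal O_D$-linear automorphism of $V\otimes_k\mathcal O_D$ such that $s^*(\beta)=\mathrm{id}_V$; arrows $(V,\beta)\to(V',\beta')$ are linear maps $f:V\to V'$ with $(f\otimes\mathrm{id})\circ\beta=\beta'\circ(f\otimes\mathrm{id})$. It is a tensor category with $(V,\beta)\otimes(V',\beta')=(V\otimes_kV',\beta\otimes_{\mathcal O_D}\beta')$. $\Sigma_D$ is the group scheme associated by Tannakian duality to $\mathcal S_D$ with the forgetful functor $(V,\beta)\mapsto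 V$. *)

(* Defs.v *)
From HB Require Import structures.
From mathcomp Require Import all_boot all_algebra.
From mathcomp Require Import mxtens ring_quotient generic_quotient.
From mathcomp Require Import boolp classical_sets topology.

Set Implicit Arguments.
Unset Strict Implicit.
Unset Printing Implicit Defensive.

Import GRing.Theory.
Local Open Scope ring_scope.
Local Open Scope classical_set_scope.
Local Open Scope quotient_scope.

(* [idealr_closed] contains properness of the ideal. *)
Record Spec (A : comNzRingType) := MkSpec {
  spec_ideal :> {pred A};
  spec_idealP : idealr_closed spec_ideal;
  spec_primeP : prime_idealr_closed spec_ideal
}.

Section Zariski.
Variable A : comNzRingType.
Implicit Types (P : Spec A) (E : set A).

HB.instance Definition _ := gen_eqMixin (Spec A).
HB.instance Definition _ := gen_choiceMixin (Spec A).

Definition vanishing E : set (Spec A) := [set P | forall a, E a -> a \in P].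

Definition zariski_open : set_system (Spec A) :=
  [set U | exists E, ~` U = vanishing E].

Lemma zariski_openT : zariski_open setT.
Proof.
exists setT; rewrite setCT; apply/esym/seteqP; split => // P VP.
by case: (spec_idealP P) => _ /negP + _; apply; apply: VP.
Qed.

Lemma zariski_openI : setI_closed zariski_open.
Proof.
move=> U V [E UE] [F VF].
exists [set c | exists2 a, E a & exists2 b, F b & c = a * b].
rewrite setCI UE VF; apply/seteqP; split => P /=.
  have [_ _ PD] := spec_idealP P.
  have P0 : 0 \in P by case: (spec_idealP P).
  have PM a u : u \in P -> a * u \in P.
    by move=> uP; have := PD a u 0 uP P0; rewrite addr0.
  case=> VP _ [a Ea [b Fb ->]]; last by apply: PM; apply: VP.
  by rewrite mulrC; apply: PM; apply: VP.
move=> VP; have [?|/existsNP[a /not_implyP[Ea /negP naP]]] := pselect (vanishing E P).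
  by left.
right => b Fb; have abP : a * b \in P by apply: VP; exists a => //; exists b.
by have := spec_primeP abP; rewrite (negbTE naP).
Qed.

Lemma zariski_open_bigU (I : Type) (f : I -> set (Spec A)) :
  (forall i, zariski_open (f i)) -> zariski_open (\bigcup_i f i).
Proof.
move=> /choice[E fE]; exists (\bigcup_i E i).
rewrite setC_bigcup; apply/seteqP; split => P /= VP.
  by move=> a [i _ Ea]; have := VP i Logic.I; rewrite fE; apply.
by move=> i _; rewrite fE => a Ea; apply: VP; exists i.
Qed.

HB.instance Definition _ := isOpenTopological.Build (Spec A)
  zariski_openT zariski_openI zariski_open_bigU.

End Zariski.

Definition closed_point (A : comNzRingType) (x : Spec A) := closed [set x].

Definition maximal_ideal (A : comNzRingType) (I : {pred A}) :=
  idealr_closed I /\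
  forall J : {pred A}, idealr_closed J -> {subset I <= J} -> J =i I.

Definition ideal_span (A : comNzRingType) (E : set A) : set A :=
  [set x | exists n (c e : 'I_n -> A),
     (forall i, E (e i)) /\ x = \sum_(i < n) c i * e i].

Definition frobenius_power (A : comNzRingType) (q : nat) (I : {pred A}) : set A :=
  ideal_span [set f ^+ q | f in [set` I]].

(* An affine group scheme is a representable group-valued functor on
   commutative [k]-algebras.  As [comAlgType] only contains nonzero rings, the
   functor is not evaluated at the zero algebra, where any representable
   functor has exactly one point. *)
Record group_functor (k : fieldType) := GroupFunctor {
  points :> comAlgType k -> groupType;
  points_map : forall R S : comAlgType k,
    {lrmorphism R -> S} -> points R -> points S;
  points_mapM : forall (R S : comAlgType k) (f : {lrmorphism R -> S}),
    {morph points_map f : x y / (x * y)%g};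
  points_map_id : forall (R : comAlgType k) (f : {lrmorphism R -> R}),
    f =1 id -> points_map f =1 id;
  points_map_comp : forall (R S T : comAlgType k) (f : {lrmorphism R -> S})
      (g : {lrmorphism S -> T}) (h : {lrmorphism R -> T}),
    h =1 g \o f -> points_map h =1 points_map g \o points_map f
}.

(* By Yoneda's lemma, an isomorphism between the functor and
   [R |-> Hom_k(coord_ring, R)] is the same as a universal point over [coord_ring]. *)
Record affine_group_scheme (k : fieldType) := AffineGroupScheme {
  gfunctor :> group_functor k;
  coord_ring : comAlgType k;
  universal_point : gfunctor coord_ring;
  classify : forall R : comAlgType k, gfunctor R -> {lrmorphism coord_ring -> R};
  classifyK : forall (R : comAlgType k) (x : gfunctor R),
    points_map (classify x) universal_point = x;
  classify_uniq : forall (R : comAlgType k) (f : {lrmorphism coord_ring -> R}),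
    classify (points_map f universal_point) =1 f
}.

Section GroupSchemes.
Variables (k : fieldType) (G : affine_group_scheme k).

Definition local_group_scheme := exists! x : Spec (coord_ring G), closed_point x.

Definition counit : {lrmorphism coord_ring G -> k^o} :=
  classify (1%g : G k^o).

Definition augmentation_ideal : set (coord_ring G) := [set f | counit f = 0].

(* The h-th iterated Frobenius morphism of [G] is trivial. *)
Definition annihilated_by_Fr (p h : nat) :=
  forall f, augmentation_ideal f -> f ^+ (p ^ h) = 0.

End GroupSchemes.

Definition finite_algebra (k : fieldType) (A : comAlgType k) :=
  exists n (b : 'I_n -> A), forall a, exists c : 'I_n -> k,
    a = \sum_(i < n) c i *: b i.

Section CategoryS.
Variables (k : fieldType) (A : comAlgType k) (s : {lrmorphism A -> k^o}).

(* [A] is the coordinate ring of D and [s] the k-point of D.  A finite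
   dimensional vector space is taken in coordinates: V = k^n is the space of
   columns, so that an O_D-linear endomorphism of V (x) O_D is a
   matrix over A acting on the left, the tensor product of such endomorphisms
   is the Kronecker product [*t], and [map_mx (in_alg R) f] is f (x) id_R. *)
Record objS := ObjS {
  dimS : nat;
  betaS : 'M[A]_dimS;
  betaS_aut : exists beta', betaS *m beta' = 1%:M /\ beta' *m betaS = 1%:M;
  betaS_point : map_mx s betaS = 1%:M
}.

(* The arrows X -> Y are the linear maps [f] satisfying [homS f]. *)
Definition homS (X Y : objS) (f : 'M[k]_(dimS Y, dimS X)) :=
  map_mx (in_alg A) f *m betaS X = betaS Y *m map_mx (in_alg A) f.

Definition unitS : objS.
Proof.
apply: (@ObjS 1 1%:M); first by exists 1%:M; rewrite mulmx1.
exact: map_mx1.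
Defined.

Lemma tensmx1 (R : pzRingType) m n : (1%:M : 'M[R]_m) *t (1%:M : 'M[R]_n) = 1%:M.
Proof.
apply/matrixP => i j; rewrite -(mxtens_unindexK i) -(mxtens_unindexK j).
case: (mxtens_unindex i) (mxtens_unindex j) => [i1 i2] [j1 j2].
rewrite tensmxE !mxE (can_eq (@mxtens_indexK _ _)) xpair_eqE.
by case: eqP; case: eqP; rewrite ?mulr1 ?mulr0.
Qed.

Definition tensorS (X Y : objS) : objS.
Proof.
apply: (@ObjS (dimS X * dimS Y) (betaS X *t betaS Y)).
- have [[bX [X1 X2]] [bY [Y1 Y2]]] := (betaS_aut X, betaS_aut Y).
  by exists (bX *t bY); rewrite !tensmx_mul X1 X2 Y1 Y2 tensmx1.
- by rewrite map_mxT !betaS_point tensmx1.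
Defined.

(* R-points of the Tannakian dual: the automorphisms of the tensor functor
   (V, beta) |-> V (x) R.  [tautV] is the inverse of [taut], hence no extra
   data. *)
Record tens_aut (R : comAlgType k) := TensAut {
  taut : forall X : objS, 'M[R]_(dimS X);
  tautV : forall X : objS, 'M[R]_(dimS X);
  tautVK : forall X, tautV X *m taut X = 1%:M;
  tautKV : forall X, taut X *m tautV X = 1%:M;
  taut_nat : forall X Y (f : 'M[k]_(dimS Y, dimS X)), homS f ->
    map_mx (in_alg R) f *m taut X = taut Y *m map_mx (in_alg R) f;
  taut_unit : taut unitS = 1%:M;
  taut_tensor : forall X Y, taut (tensorS X Y) = taut X *t taut Y
}.

Section Group.
Variable R : comAlgType k.
Implicit Types g h : tens_aut R.

Lemma tens_aut_eq g h : (forall X, taut g X = taut h X) -> g = h.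
Proof.
case: g h => [t v vK Kv n u t2] [t' v' vK' Kv' n' u' t2'] /= tt'.
have ett : t = t' by apply: functional_extensionality_dep.
case: _ / ett in n' u' t2' vK' Kv' tt' *.
have evv : v = v'.
  apply: functional_extensionality_dep => X.
  by rewrite -[v X]mulmx1 -(Kv' X) mulmxA vK mul1mx.
case: _ / evv in vK' Kv' *.
by rewrite (Prop_irrelevance vK' vK) (Prop_irrelevance Kv' Kv)
           (Prop_irrelevance n' n) (Prop_irrelevance u' u)
           (Prop_irrelevance t2' t2).
Qed.

Definition tens_aut_one : tens_aut R.
Proof.
apply: (@TensAut R (fun=> 1%:M) (fun=> 1%:M)) => [X|X|X Y f _||X Y].
- by rewrite mulmx1.
- by rewrite mulmx1.
- by rewrite mulmx1 mul1mx.
- by [].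
- by rewrite tensmx1.
Defined.

Definition tens_aut_inv g : tens_aut R.
Proof.
apply: (@TensAut R (tautV g) (taut g)) => [X|X|X Y f Hf||X Y].
- exact: tautKV.
- exact: tautVK.
- transitivity (tautV g Y *m (taut g Y *m map_mx (in_alg R) f) *m tautV g X).
    by rewrite mulmxA tautVK mul1mx.
  by rewrite -(taut_nat g Hf) -!mulmxA tautKV mulmx1.
- by have := tautVK g unitS; rewrite taut_unit mulmx1.
- transitivity (tautV g (tensorS X Y) *m
    ((taut g X *t taut g Y) *m (tautV g X *t tautV g Y))).
    by rewrite tensmx_mul !tautKV tensmx1 mulmx1.
  by rewrite -taut_tensor mulmxA tautVK mul1mx.
Defined.

Definition tens_aut_mul g h : tens_aut R.
Proof.
apply: (@TensAut R (fun X => taut g X *m taut h X)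
                   (fun X => tautV h X *m tautV g X)) => [X|X|X Y f Hf||X Y].
- by rewrite mulmxA -(mulmxA (tautV h X)) tautVK mulmx1 tautVK.
- by rewrite mulmxA -(mulmxA (taut g X)) tautKV mulmx1 tautKV.
- by rewrite mulmxA (taut_nat g Hf) -!mulmxA (taut_nat h Hf).
- by rewrite !taut_unit mulmx1.
- by rewrite !taut_tensor tensmx_mul.
Defined.

HB.instance Definition _ := gen_eqMixin (tens_aut R).
HB.instance Definition _ := gen_choiceMixin (tens_aut R).

Lemma tens_aut_mulA : associative tens_aut_mul.
Proof. by move=> g h i; apply: tens_aut_eq => X /=; rewrite mulmxA. Qed.
Lemma tens_aut_mul1 : left_id tens_aut_one tens_aut_mul.
Proof. by move=> g; apply: tens_aut_eq => X /=; rewrite mul1mx. Qed.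
Lemma tens_aut_1mul : right_id tens_aut_one tens_aut_mul.
Proof. by move=> g; apply: tens_aut_eq => X /=; rewrite mulmx1. Qed.
Lemma tens_aut_mulV : left_inverse tens_aut_one tens_aut_inv tens_aut_mul.
Proof. by move=> g; apply: tens_aut_eq => X /=; rewrite tautVK. Qed.
Lemma tens_aut_Vmul : right_inverse tens_aut_one tens_aut_inv tens_aut_mul.
Proof. by move=> g; apply: tens_aut_eq => X /=; rewrite tautKV. Qed.

HB.instance Definition _ := isGroup.Build (tens_aut R)
  tens_aut_mulA tens_aut_mul1 tens_aut_1mul tens_aut_mulV tens_aut_Vmul.

End Group.

Lemma map_in_alg (R S : comAlgType k) (f : {lrmorphism R -> S}) m n
    (M : 'M[k]_(m, n)) :
  map_mx f (map_mx (in_alg R) M) = map_mx (in_alg S) M.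
Proof. by apply/matrixP => i j; rewrite !mxE rmorph_alg. Qed.

Definition tens_aut_map (R S : comAlgType k) (f : {lrmorphism R -> S})
  (g : tens_aut R) : tens_aut S.
Proof.
apply: (@TensAut S (fun X => map_mx f (taut g X))
                   (fun X => map_mx f (tautV g X))) => [X|X|X Y u Hu||X Y].
- by rewrite -map_mxM tautVK map_mx1.
- by rewrite -map_mxM tautKV map_mx1.
- by rewrite -!(map_in_alg f) -!map_mxM (taut_nat g Hu).
- by rewrite taut_unit map_mx1.
- by rewrite taut_tensor map_mxT.
Defined.

Definition tens_aut_functor : group_functor k.
Proof.
apply: (@GroupFunctor k (fun R => tens_aut R) tens_aut_map).
- by move=> R S f g h; apply: tens_aut_eq => X /=; rewrite map_mxM.
- move=> R f f1 g; apply: tens_aut_eq => X /=.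
  by apply/matrixP => i j; rewrite mxE f1.
- move=> R S T f g h hgf x; apply: tens_aut_eq => X /=.
  by apply/matrixP => i j; rewrite !mxE hgf.
Defined.

(* The coordinate ring of the Tannakian dual is realized as the algebra of
   polynomial expressions in the entries of [taut g X] and [tautV g X], two of
   them being identified when they take the same value at every point [g].  It
   represents [tens_aut_functor], which is what [Sigma] below records. *)
Inductive sterm :=
| SConst of k
| SEntry (X : objS) of 'I_(dimS X) & 'I_(dimS X)
| SEntryV (X : objS) of 'I_(dimS X) & 'I_(dimS X)
| SAdd of sterm & sterm
| SMul of sterm & sterm.

Fixpoint seval (R : comAlgType k) (g : tens_aut R) (t : sterm) : R :=
  match t with
  | SConst c => c%:A
  | SEntry X i j => taut g X i j
  | SEntryV X i j => tautV g X i j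
  | SAdd t u => seval g t + seval g u
  | SMul t u => seval g t * seval g u
  end.

HB.instance Definition _ := gen_eqMixin sterm.
HB.instance Definition _ := gen_choiceMixin sterm.

Definition steq (t u : sterm) : bool :=
  `[< forall (R : comAlgType k) (g : tens_aut R), seval g t = seval g u >].

Lemma steq_refl : reflexive steq. Proof. by move=> t; apply/asboolP. Qed.
Lemma steq_sym : symmetric steq.
Proof. by move=> t u; apply/asboolP/asboolP => + R g => ->. Qed.
Lemma steq_trans : transitive steq.
Proof.
by move=> t u v /asboolP ut /asboolP tv; apply/asboolP => R g; rewrite ut.
Qed.

Canonical steq_equiv := EquivRel steq steq_refl steq_sym steq_trans.

Definition sring := {eq_quot steq_equiv}.
HB.instance Definition _ := Choice.on sring.
HB.instance Definition _ := EqQuotient.on sring.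

Definition sring_val (R : comAlgType k) (g : tens_aut R) (x : sring) : R :=
  seval g (repr x).

Lemma sring_val_pi (R : comAlgType k) (g : tens_aut R) t :
  sring_val g (\pi_sring t) = seval g t.
Proof.
rewrite /sring_val; have /eqmodP /asboolP : repr (\pi_sring t) = t %[mod sring].
  by rewrite reprK.
exact.
Qed.

Lemma sring_ext (x y : sring) :
  (forall (R : comAlgType k) (g : tens_aut R), sring_val g x = sring_val g y) -> x = y.
Proof.
move=> xy; rewrite -[x]reprK -[y]reprK; apply/eqmodP/asboolP => R g.
exact: xy.
Qed.

Definition sconst c : sring := \pi_sring (SConst c).
Definition sadd (x y : sring) : sring := \pi_sring (SAdd (repr x) (repr y)).
Definition smul (x y : sring) : sring := \pi_sring (SMul (repr x) (repr y)).
Definition sopp (x : sring) : sring := smul (sconst (-1)) x.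
Definition sscale (c : k) (x : sring) : sring := smul (sconst c) x.

Section SringVal.
Variables (R : comAlgType k) (g : tens_aut R).
Lemma sring_valC c : sring_val g (sconst c) = c%:A.
Proof. exact: sring_val_pi. Qed.
Lemma sring_valD x y : sring_val g (sadd x y) = sring_val g x + sring_val g y.
Proof. exact: sring_val_pi. Qed.
Lemma sring_valM x y : sring_val g (smul x y) = sring_val g x * sring_val g y.
Proof. exact: sring_val_pi. Qed.
Lemma sring_valN x : sring_val g (sopp x) = - sring_val g x.
Proof. by rewrite sring_valM sring_valC scaleN1r mulN1r. Qed.
Lemma sring_valZ c x : sring_val g (sscale c x) = c *: sring_val g x.
Proof. by rewrite sring_valM sring_valC mulr_algl. Qed.
Definition sring_valE := (sring_valC, sring_valD, sring_valN, sring_valZ, sring_valM).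
End SringVal.

Lemma saddA : associative sadd.
Proof. by move=> x y z; apply: sring_ext => R g; rewrite !sring_valE addrA. Qed.
Lemma saddC : commutative sadd.
Proof. by move=> x y; apply: sring_ext => R g; rewrite !sring_valE addrC. Qed.
Lemma sadd0 : left_id (sconst 0) sadd.
Proof. by move=> x; apply: sring_ext => R g; rewrite !sring_valE scale0r add0r. Qed.
Lemma saddN : left_inverse (sconst 0) sopp sadd.
Proof. by move=> x; apply: sring_ext => R g; rewrite !sring_valE scale0r addNr. Qed.

HB.instance Definition _ := GRing.isZmodule.Build sring saddA saddC sadd0 saddN.

Lemma smulA : associative smul.
Proof. by move=> x y z; apply: sring_ext => R g; rewrite !sring_valE mulrA. Qed.
Lemma smulC : commutative smul.
Proof. by move=> x y; apply: sring_ext => R g; rewrite !sring_valE mulrC. Qed.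
Lemma smul1 : left_id (sconst 1) smul.
Proof. by move=> x; apply: sring_ext => R g; rewrite !sring_valE scale1r mul1r. Qed.
Lemma smulDl : left_distributive smul sadd.
Proof. by move=> x y z; apply: sring_ext => R g; rewrite !sring_valE mulrDl. Qed.
Lemma sone_neq0 : sconst 1 != sconst 0.
Proof.
apply/eqP => /(congr1 (sring_val (tens_aut_one k^o))) /eqP.
by rewrite !sring_valE scale1r scale0r oner_eq0.
Qed.

HB.instance Definition _ := GRing.Zmodule_isComNzRing.Build sring
  smulA smulC smul1 smulDl sone_neq0.

Lemma sscaleA a b v : sscale a (sscale b v) = sscale (a * b) v.
Proof. by apply: sring_ext => R g; rewrite !sring_valE scalerA. Qed.
Lemma sscale1 : left_id 1 sscale.
Proof. by move=> x; apply: sring_ext => R g; rewrite !sring_valE scale1r. Qed.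
Lemma sscaleDr : right_distributive sscale +%R.
Proof.
move=> a x y; apply: sring_ext => R g.
by rewrite -![_ + _]/(sadd _ _) !sring_valE scalerDr.
Qed.
Lemma sscaleDl v : {morph sscale^~ v : a b / a + b}.
Proof.
move=> a b; apply: sring_ext => R g.
by rewrite -[sscale a v + _]/(sadd _ _) !sring_valE scalerDl.
Qed.

HB.instance Definition _ := GRing.Zmodule_isLmodule.Build k sring
  sscaleA sscale1 sscaleDr sscaleDl.

Lemma sscaleAl (a : k) (x y : sring) : a *: (x * y) = a *: x * y.
Proof.
apply: sring_ext => R g.
by rewrite -![_ * y]/(smul _ _) -![_ *: _]/(sscale _ _) !sring_valE scalerAl.
Qed.

HB.instance Definition _ := GRing.Lmodule_isLalgebra.Build k sring sscaleAl.
HB.instance Definition _ := GRing.Lalgebra_isComAlgebra.Build k sring.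

Section SringValMorphism.
Variables (R : comAlgType k) (g : tens_aut R).

Lemma sring_val_is_zmod_morphism : zmod_morphism (sring_val g).
Proof. by move=> x y; rewrite -[x - y]/(sadd x (sopp y)) !sring_valE. Qed.
Lemma sring_val_is_monoid_morphism : monoid_morphism (sring_val g).
Proof.
by split=> [|x y]; [rewrite -[1]/(sconst 1) sring_valC scale1r | exact: sring_valM].
Qed.
Lemma sring_val_is_scalable : scalable (sring_val g).
Proof. by move=> c x; exact: sring_valZ. Qed.

HB.instance Definition _ :=
  GRing.isZmodMorphism.Build sring R (sring_val g) sring_val_is_zmod_morphism.
HB.instance Definition _ :=
  GRing.isMonoidMorphism.Build sring R (sring_val g) sring_val_is_monoid_morphism.
HB.instance Definition _ :=
  GRing.isScalable.Build k sring R *:%R (sring_val g) sring_val_is_scalable.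

End SringValMorphism.

Lemma smx_ext m n (M N : 'M[sring]_(m, n)) :
  (forall (R : comAlgType k) (g : tens_aut R),
     map_mx (sring_val g) M = map_mx (sring_val g) N) -> M = N.
Proof.
move=> MN; apply/matrixP => i j; apply: sring_ext => R g.
by have /matrixP/(_ i j) := MN R g; rewrite !mxE.
Qed.

Definition suniv_mx (X : objS) : 'M[sring]_(dimS X) :=
  \matrix_(i, j) \pi_sring (SEntry i j).
Definition suniv_mxV (X : objS) : 'M[sring]_(dimS X) :=
  \matrix_(i, j) \pi_sring (SEntryV i j).

Lemma sring_val_univ (R : comAlgType k) (g : tens_aut R) X :
  map_mx (sring_val g) (suniv_mx X) = taut g X.
Proof. by apply/matrixP => i j; rewrite !mxE sring_val_pi. Qed.
Lemma sring_val_univV (R : comAlgType k) (g : tens_aut R) X :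
  map_mx (sring_val g) (suniv_mxV X) = tautV g X.
Proof. by apply/matrixP => i j; rewrite !mxE sring_val_pi. Qed.

Definition suniv : tens_aut sring.
Proof.
apply: (@TensAut sring suniv_mx suniv_mxV) => [X|X|X Y f Hf||X Y];
  apply: smx_ext => R g.
- by rewrite map_mxM sring_val_univ sring_val_univV tautVK map_mx1.
- by rewrite map_mxM sring_val_univ sring_val_univV tautKV map_mx1.
- by rewrite !map_mxM !map_in_alg !sring_val_univ taut_nat.
- by rewrite sring_val_univ taut_unit map_mx1.
- by rewrite map_mxT !sring_val_univ taut_tensor.
Defined.

Lemma sring_val_suniv (R : comAlgType k) (g : tens_aut R) :
  tens_aut_map (sring_val g) suniv = g.
Proof. by apply: tens_aut_eq => X /=; rewrite sring_val_univ. Qed.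

Lemma sring_val_uniq (R : comAlgType k) (f : {lrmorphism sring -> R}) :
  sring_val (tens_aut_map f suniv) =1 f.
Proof.
move=> x; rewrite -[x in RHS]reprK /sring_val.
elim: (repr x) => {x} /= [c|X i j|X i j|t IHt u IHu|t IHt u IHu].
- have -> : \pi_sring (SConst c) = c%:A :> sring.
    by apply: sring_ext => R' g; rewrite sring_val_pi linearZ rmorph1.
  by rewrite rmorph_alg.
- by rewrite !mxE.
- by rewrite !mxE.
- have -> : \pi_sring (SAdd t u) = \pi_sring t + \pi_sring u :> sring.
    by apply: sring_ext => R' g; rewrite rmorphD /= !sring_val_pi.
  by rewrite rmorphD IHt IHu.
- have -> : \pi_sring (SMul t u) = \pi_sring t * \pi_sring u :> sring.
    by apply: sring_ext => R' g; rewrite rmorphM /= !sring_val_pi.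
  by rewrite rmorphM IHt IHu.
Qed.

Definition Sigma : affine_group_scheme k :=
  @AffineGroupScheme k tens_aut_functor sring suniv
    (fun R (g : tens_aut R) => sring_val g) sring_val_suniv sring_val_uniq.

End CategoryS.

(* Main.v *)
(* A finite connected D has nilpotent maximal ideal, so every [betaS X] becomes
   the identity after raising its entries to the power q = p ^ h.  The invariants
   W of the cyclic shift on the tensor power X^(q) form an object of S_D (the
   category has kernels).  Reading off the coefficient of the diagonal
   multi-index (i, ..., i) is an arrow from W to the unit: in the matrix
   product the shift-invariant sum over all other multi-indices collapses to
   the fixed ones, since the remaining orbits have size divisible by p.  A
   tensor automorphism g commutes with this arrow and with the inclusion of W
   in X^(q), and W contains the diagonal vectors e_j (x) ... (x) e_j; comparing
   coefficients gives (g_X i j) ^ q = delta i j.  Thus the augmentation ideal is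
   killed by Fr^h, and, being nil, it is the only prime ideal.  Conversely
   [betaS] itself is a point of Sigma_D over O(D), and at (k, 1 + a) it sends an
   element of the augmentation ideal to a, for any a in the maximal ideal. *)
Require Import Defs.
From HB Require Import structures.
From mathcomp Require Import all_boot all_algebra.
From mathcomp Require Import fingroup perm action cyclic mxtens generic_quotient.
From mathcomp Require Import boolp classical_sets topology.

Set Implicit Arguments.
Unset Strict Implicit.
Unset Printing Implicit Defensive.

Import GRing.Theory.
Local Open Scope ring_scope.
Local Open Scope classical_set_scope.

(** * Prime ideals and the Zariski topology *)

Section CommutativeAlgebra.
Variable A : comNzRingType.

(** Zorn's lemma on the proper ideals containing [x]: a maximal one is prime. *)
Lemma unit_or_in_prime (x : A) :
  (exists y, x * y = 1) \/ (exists P : Spec A, x \in P).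
Proof.
have [|xN1] := pselect (exists y, x * y = 1); [by left | right].
pose proper_ideal (I : set A) :=
  [/\ I x, ~ I 1 & forall a u v, I u -> I v -> I (a * u + v)].
have [|M [PM Mmax]] := @Zorn_bigcup _ [set I | I = set0 \/ proper_ideal I].
  move=> F FP Ftot /=.
  have [[a [I FI Ia]]|F0] := pselect (exists a, (\bigcup_(X in F) X) a);
    last by left; apply/seteqP; split=> // a Fa; case: F0; exists a.
  have PI J b : F J -> J b -> proper_ideal J.
    by move=> FJ Jb; have /= [J0|//] := FP J FJ; rewrite J0 in Jb.
  right; split=> [|[J FJ J1]|c u v [J FJ Ju] [K FK Kv]].
  - by exists I => //; have [] := PI _ _ FI Ia.
  - by have [_ /(_ J1)] := PI _ _ FJ J1.
  - have [JK|KJ] := Ftot J K FJ FK.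
      exists K => //; have [_ _] := PI _ _ FK Kv; apply=> //; exact: JK.
    exists J => //; have [_ _] := PI _ _ FJ Ju; apply=> //; exact: KJ.
have {PM} [Mx M1 MD] : proper_ideal M.
  case: PM => // M0; case: (Mmax [set x * y | y in setT]).
    rewrite M0; split=> // xA; apply: (xA x); exists 1 => //; exact: mulr1.
  right; split=> [|[z _ xz1]|a _ _ [u _ <-] [v _ <-]].
  - by exists 1; rewrite ?mulr1.
  - by apply: xN1; exists z.
  - by exists (a * u + v) => //; rewrite mulrDr mulrCA.
have M0 : M 0 by have := MD (-1) x x Mx Mx; rewrite mulN1r addNr.
have MM a u : M u -> M (a * u).
  by move=> Mu; have := MD a u 0 Mu M0; rewrite addr0.
have IM : idealr_closed [pred a | `[< M a >]].
  split; [exact/asboolP | by apply/negP => /asboolP |].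
  by move=> a u v /asboolP Mu /asboolP Mv; apply/asboolP; apply: MD.
suff pM : prime_idealr_closed [pred a | `[< M a >]].
  by exists (MkSpec IM pM); apply/asboolP.
move=> u v /asboolP Muv; rewrite !inE.
have [Mu|Mu] := pselect (M u); first by rewrite [`[<_>]]asboolT.
apply/orP; right; apply/asboolP.
(* As [u] is not in [M], maximality puts 1 in [N]; multiplying by [v] then puts [v] in [M]. *)
pose N := [set m + u * c | m in M & c in setT].
have MN : M `<` N.
  split=> [a Ma|NM]; first by exists a => //; exists 0; rewrite ?mulr0 ?addr0.
  by apply/Mu/NM; exists 0 => //; exists 1; rewrite // mulr1 add0r.
have [N1|N1] := pselect (N 1).
  case: N1 => m Mm [c _] e.
  have -> : v = v * m + c * (u * v).
    by rewrite -[LHS]mulr1 -e mulrDr mulrCA [c * _]mulrCA [v * c]mulrC.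
  by apply: MD => //; apply: MM.
case: (Mmax N MN); right; split=> //.
  by exists x => //; exists 0; rewrite ?mulr0 ?addr0.
move=> a _ _ [m Mm [c _ <-]] [n Mn [d _ <-]].
exists (a * m + n); first exact: MD.
by exists (a * c + d) => //; rewrite !mulrDr addrACA (mulrCA u).
Qed.

Lemma idealrM (P : {pred A}) (a u : A) : idealr_closed P -> u \in P -> a * u \in P.
Proof. by case=> P0 _ PD uP; have := PD a u 0 uP P0; rewrite addr0. Qed.

Lemma prime_idealX (P : Spec A) (a : A) n : a ^+ n \in P -> a \in P.
Proof.
elim: n => [|n IHn].
  by rewrite expr0; case: (spec_idealP P) => _ /negP.
by rewrite exprS => /spec_primeP/orP[].
Qed.

Lemma vanishing_closed (E : set A) : closed (vanishing E).
Proof.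
rewrite -[vanishing E]setCK; apply: open_closedC.
by exists E; rewrite setCK.
Qed.

Lemma vanishing_open (E : set A) (F : set A) :
  ~` vanishing E = vanishing F -> open (vanishing E).
Proof. by exists F. Qed.

Lemma Spec_eq (P Q : Spec A) : P =i Q -> P = Q.
Proof.
case: P Q => [P iP pP] [Q iQ pQ] /= PQ.
have ePQ : P = Q :> {pred A} by apply/funext => a; apply: PQ.
case: _ / ePQ in iQ pQ PQ *.
by rewrite (Prop_irrelevance iQ iP) (Prop_irrelevance pQ pP).
Qed.

End CommutativeAlgebra.

(** * Nilpotence of the kernel of a rational point *)

Section NilpotentKernel.
Variable k : fieldType.
Implicit Types (A : comAlgType k).

(* The powers of an element stabilise as an ideal: a linear relation between
   [1, a, ..., a ^+ n], divided by its lowest coefficient [v 0 j], reads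
   [a ^+ j = a ^+ j.+1 * r]. *)
Lemma finite_algebra_pow A : finite_algebra A ->
  exists n, forall a : A, exists r, a ^+ n = a ^+ n.+1 * r.
Proof.
case=> n [b bP]; exists n => a.
have [c cP] := choice (fun i : 'I_n.+1 => bP (a ^+ i)).
pose C := \matrix_(i < n.+1, j < n) c i j.
have /rowV0Pn[v /sub_kermxP vC v0] : kermx C != 0.
  rewrite kermx_eq0 /row_free; apply/eqP => rC.
  by have := rank_leq_col C; rewrite rC ltnn.
have rel : \sum_(i < n.+1) v 0 i *: a ^+ i = 0.
  under eq_bigr do rewrite cP scaler_sumr.
  rewrite exchange_big big1 //= => j _.
  under eq_bigr do rewrite scalerA.
  rewrite -scaler_suml; have /matrixP/(_ 0 j) := vC.
  rewrite !mxE => vCj.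
  rewrite (eq_bigr (fun i => v 0 i * C i j)) ?vCj ?scale0r // => i _.
  by rewrite mxE.
have [j vj jmin] : exists2 j : 'I_n.+1, v 0 j != 0 &
    forall i : 'I_n.+1, (i < j)%N -> v 0 i = 0.
  have [j0 vj0] : exists j, v 0 j != 0.
    by move/rV0Pn: v0.
  case: (@arg_minnP _ j0 (fun i => v 0 i != 0) (@nat_of_ord _) vj0) => j vj jmin.
  by exists j => // i ij; apply/eqP; apply: contraLR ij => /jmin; rewrite leqNgt.
have [r jr] : exists r, a ^+ j = a ^+ j.+1 * r.
  exists (- (v 0 j)^-1 *: \sum_(i < n.+1 | i != j) v 0 i *: a ^+ (i - j.+1)).
  have := rel; rewrite (bigD1 j) //= => /eqP; rewrite addr_eq0 => /eqP vaj.
  rewrite -scalerAr mulr_sumr scaleNr -scalerN.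
  apply: (scalerI vj); rewrite scalerA mulfV // scale1r vaj; congr (- _).
  apply: eq_bigr => i ij; rewrite -scalerAr -exprD.
  have [lij|] := ltnP i j; first by rewrite jmin // !scale0r.
  by rewrite leq_eqVlt (inj_eq val_inj) eq_sym (negPf ij) /= => /subnKC->.
(* [j] depends on [a]; multiplying by [a ^+ (n - j)] gives the uniform exponent [n]. *)
have jn : (j <= n)%N by rewrite -ltnS.
exists r; rewrite -(subnK jn) exprD {1}jr mulrA -exprD.
by rewrite addnS.
Qed.

Variables (A : comAlgType k) (s : {lrmorphism A -> k^o}).

Lemma rmorph_ker_ideal : idealr_closed [pred a | s a == 0].
Proof.
split=> [||a u v /eqP su /eqP sv]; rewrite inE ?rmorph0 ?rmorph1 ?oner_eq0 //.
by rewrite rmorphD rmorphM /= su sv mulr0 addr0.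
Qed.

Lemma rmorph_ker_prime : prime_idealr_closed [pred a | s a == 0].
Proof. by move=> u v; rewrite !inE rmorphM mulf_eq0. Qed.

Definition rmorph_ker : Spec A := MkSpec rmorph_ker_ideal rmorph_ker_prime.

(** With [b = 1 - a * r], [a ^+ n * b = 0] makes the zero loci of [a] and [b] complementary, hence
    clopen. That of [a] contains the kernel of [s], so it is everything and [b] is a unit. *)
Lemma nilpotent_kernel : finite_algebra A -> connected [set: Spec A] ->
  exists n, forall a, s a = 0 -> a ^+ n = 0.
Proof.
move=> /finite_algebra_pow[n An] Aconn; exists n => a sa.
have [r ar] := An a; pose b := 1 - a * r.
have ab : a ^+ n * b = 0 by rewrite mulrBr mulr1 mulrA -exprSr -ar subrr.
have VaE : ~` vanishing [set a] = vanishing [set b].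
  apply/seteqP; split=> P /= VP.
    move=> _ ->; have : a ^+ n * b \in P by rewrite ab; case: (spec_idealP P).
    case/spec_primeP/orP => // /prime_idealX aP.
    by case: VP => _ ->.
  move=> /(_ a erefl) aP; case: (spec_idealP P) => _ /negP + PD; apply.
  have := PD r a b aP (VP b erefl); by rewrite mulrC addrC subrK.
have VaT : vanishing [set a] = [set: Spec A].
  apply: Aconn.
  - by exists rmorph_ker => _ ->; rewrite inE sa.
  - by exists (vanishing [set a]); [exact: vanishing_open VaE | rewrite setTI].
  - by exists (vanishing [set a]); [exact: vanishing_closed | rewrite setTI].
have [[u bu]|[P bP]] := unit_or_in_prime b.
  by rewrite -[a ^+ n]mulr1 -bu mulrA ab mul0r.
have : vanishing [set b] P by move=> _ ->.
by rewrite -VaE VaT setCT.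
Qed.

Hypothesis ker_nil : forall a, s a = 0 -> exists n, a ^+ n = 0.

(** If [s a] were nonzero, [1 - (s a)^-1 *: a] would be nilpotent and congruent to 1 modulo [a],
    putting 1 in [I]. *)
Lemma ideal_sub_kernel (I : {pred A}) : idealr_closed I ->
  forall a, a \in I -> s a = 0.
Proof.
move=> iI a aI; apply/eqP/negPn/negP => sa.
have [n an] : exists n, (1 - (s a)^-1 *: a) ^+ n = 0.
  by apply: ker_nil; rewrite linearB linearZ rmorph1 /= -[_ *: _]/(_ * _) mulVf // subrr.
suff [c] : exists c, 1 = (1 - (s a)^-1 *: a) ^+ n + c * a.
  rewrite an add0r => e; case: (iI) => _ /negP + _; apply.
  by rewrite e; apply: idealrM.
elim: n {an} => [|n [c IHn]]; first by exists 0; rewrite mul0r addr0.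
exists ((1 - (s a)^-1 *: a) ^+ n * (s a)^-1%:A + c).
by rewrite exprSr mulrDl -mulrA mulr_algl addrA -mulrDr subrK mulr1.
Qed.

Lemma maximal_ideal_kernel (m : {pred A}) : maximal_ideal m ->
  forall a, (a \in m) = (s a == 0).
Proof.
move=> [im mmax] a; rewrite -(mmax _ rmorph_ker_ideal) //.
by move=> b /(ideal_sub_kernel im) sb; rewrite inE sb.
Qed.

(** A prime contains all nilpotents and, being proper, lies in the kernel of [s]: the spectrum is
    one point. *)
Lemma unique_closed_point : exists! x : Spec A, closed_point x.
Proof.
have uniq (P : Spec A) : P = rmorph_ker.
  apply: Spec_eq => a; apply/idP/idP => [aP|].
    by apply/eqP; apply: (ideal_sub_kernel (spec_idealP P)).
  move=> /eqP/ker_nil[n an]; apply: (@prime_idealX _ _ _ n).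
  by rewrite an; case: (spec_idealP P).
exists rmorph_ker; split=> [|P _]; last exact/esym/uniq.
rewrite /closed_point (_ : [set _] = setT); first exact: closedT.
by apply/seteqP; split=> // P _; apply: uniq.
Qed.

End NilpotentKernel.

(** * Invariant sums in characteristic [p] *)

Section OrbitSums.
Variables (R : nzRingType) (p : nat).
Hypothesis char_R : p \in [pchar R].

(* The orbits outside the fixed locus have cardinality divisible by [p]. *)
Lemma sum_perm_pchar (T : finType) (u : {perm T}) h (F : T -> R) :
  (u ^+ (p ^ h))%g = 1%g -> (forall x, F (u x) = F x) ->
  (forall x, u x = x -> F x = 0) -> \sum_x F x = 0.
Proof.
move=> uq Fu F0; have p_pr := pcharf_prime char_R.
have actsT : [acts <[u]>%g, on [set: T]%SET | 'P].
  by apply/actsP => v _ x; rewrite !inE.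
rewrite (eq_bigl [in [set: T]%SET]) => [|x]; last by rewrite inE.
rewrite (set_partition_big _ (orbit_partition actsT)) /=.
rewrite big1 // => _ /imsetP[x _ ->].
have Forb y : y \in orbit 'P <[u]>%g x -> F y = F x.
  case/orbitP => v /cycleP[n ->] <-; rewrite /= apermE.
  by elim: n => [|n IHn]; rewrite ?perm1 // expgSr permM Fu.
rewrite (eq_bigr _ Forb) sumr_const.
have [ux|ux] := eqVneq (u x) x; first by rewrite F0 // mul0rn.
have /(dvdn_pfactor _ _ p_pr)[[|n] _] : (#|orbit 'P <[u]>%g x| %| p ^ h)%N.
- by apply: dvdn_trans (dvdn_orbit _ _ _) _; rewrite -[#|_|]/(#[u]%g) order_dvdn uq.
- move=> /card_orbit1 orb1; case/eqP: ux; apply/set1P; rewrite -orb1.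
  by apply: (mem_orbit 'P x); apply: cycle_id.
by move=> ->; rewrite expnS mulrnA (mulrn_pchar char_R) mul0rn.
Qed.

End OrbitSums.

Lemma rot_tuple_fixed T q (t : q.+1.-tuple T) :
  rot_tuple 1 t = t -> exists i, t = nseq_tuple q.+1 i.
Proof.
case/tupleP: t => i t /(congr1 val) /=; rewrite rot1_cons => rt.
exists i; apply: val_inj => /=; congr cons.
suff nseqP (u : seq T) : rcons u i = i :: u -> u = nseq (size u) i.
  by rewrite [LHS](nseqP _ rt) size_tuple.
by elim: u => //= j u IHu [-> /IHu <-].
Qed.

(** * Kernels in the category of pairs (V, beta) *)

Section Kernels.
Variables (k : fieldType) (A : comAlgType k) (s : {lrmorphism A -> k^o}).

Notation E := (map_mx (in_alg A)).

(* Both [f *m iota = 0] and the universal property hold already over [k], where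
   they are witnessed by matrix identities; these persist over [A]. *)
Lemma kernelS (X Y : objS s) (f : 'M[k]_(dimS Y, dimS X)) : homS f ->
  exists (K : objS s) (iota : 'M[k]_(dimS X, dimS K)),
    [/\ homS iota, f *m iota = 0 &
        forall n (z : 'M_(dimS X, n)), f *m z = 0 -> exists y, z = iota *m y].
Proof.
(* The columns of [D] span the kernel of [f], and those of [iota] are a basis of it; [lam] below
   reads off coordinates. *)
move=> fXY; pose D := cokermx f; pose iota := col_base D.
have baseD : iota *m row_base D = D by exact: mulmx_base.
have [lam lamK] : exists lam, lam *m iota = 1%:M.
  exact/row_fullP/col_base_full.
have lamKE (R : comAlgType k) :
    map_mx (in_alg R) lam *m map_mx (in_alg R) iota = 1%:M.
  by rewrite -map_mxM lamK map_mx1.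
have [rho rhoK] : exists rho, row_base D *m rho = 1%:M.
  exact/row_freeP/row_base_free.
have fi : f *m iota = 0.
  by rewrite -[iota]mulmx1 -rhoK (mulmxA iota) baseD mulmxA mulmx_coker mul0mx.
clearbody iota.
(* The projector complementary to [iota *m lam] kills the kernel of [f], so it factors through
   [f]. *)
have [mu muE] : exists mu, 1%:M - iota *m lam = mu *m f.
  apply/submxP; rewrite submxE -/D mulmxBl mul1mx.
  suff -> : iota *m lam *m D = D by rewrite subrr.
  transitivity (iota *m lam *m (iota *m row_base D)); first by rewrite baseD.
  by rewrite mulmxA -(mulmxA iota) lamK mulmx1.
(* A matrix intertwined by [f] preserves the kernel; restricting the inverse of [betaS X] too gives
   the inverse of the restriction. *)
have stable B B' : E f *m B = B' *m E f ->
    E iota *m (E lam *m B *m E iota) = B *m E iota.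
  move=> fB; rewrite !mulmxA -map_mxM.
  have -> : iota *m lam = 1%:M - mu *m f by rewrite -muE opprB addrC subrK.
  rewrite map_mxB map_mx1 map_mxM 2!mulmxBl mul1mx.
  rewrite -(mulmxA _ (E f) B) fB.
  by rewrite -!mulmxA -map_mxM fi map_mx0 !mulmx0 subr0.
have mul B C C' : E f *m C = C' *m E f -> B *m C = 1%:M ->
   (E lam *m B *m E iota) *m (E lam *m C *m E iota) = 1%:M.
  move=> fC BC; rewrite -mulmxA (stable C C' fC) mulmxA -(mulmxA _ B) BC mulmx1.
  exact: lamKE.
have [bX [bXV bVX]] := betaS_aut X; have [bY [bYV bVY]] := betaS_aut Y.
have fV : E f *m bX = bY *m E f.
  rewrite -{1}[E f]mul1mx -bVY -(mulmxA bY) -fXY.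
  by rewrite -!mulmxA bXV mulmx1.
pose B := E lam *m betaS X *m E iota.
have B_aut : exists B', B *m B' = 1%:M /\ B' *m B = 1%:M.
  exists (E lam *m bX *m E iota).
  by split; [apply: mul fV bXV | apply: mul fXY bVX].
have B_point : map_mx s B = 1%:M.
  rewrite !map_mxM !map_in_alg betaS_point mulmx1.
  exact: (lamKE k^o).
exists (ObjS B_aut B_point), iota; split=> //.
  exact: stable fXY.
move=> n z fz; exists (lam *m z); apply/eqP.
by rewrite mulmxA -subr_eq0 -{1}[z]mul1mx -mulmxBl muE -mulmxA fz mulmx0.
Qed.

End Kernels.

(** * Tensor powers and their cyclic shift *)

Section TensorPowers.
Variables (k : fieldType) (A : comAlgType k) (s : {lrmorphism A -> k^o}).
Variable X : objS s.

Fixpoint powS q : objS s := if q is q'.+1 then tensorS X (powS q') else unitS s.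

(** Basis indices of the tensor power are multi-indices, flattened by the Kronecker product. *)
Fixpoint dec q : 'I_(dimS (powS q)) -> q.-tuple 'I_(dimS X) :=
  if q is q'.+1 then fun I =>
    let ij := mxtens_unindex (I : 'I_(dimS X * dimS (powS q'))) in
    cons_tuple ij.1 (dec ij.2)
  else fun=> [tuple].

Fixpoint enc q : q.-tuple 'I_(dimS X) -> 'I_(dimS (powS q)) :=
  if q is q'.+1 then fun t => mxtens_index (thead t, enc (behead_tuple t))
  else fun=> ord0.

Lemma dec_cons q i (J : 'I_(dimS (powS q))) :
  dec (q := q.+1) (mxtens_index (i, J)) = cons_tuple i (dec J).
Proof.
pose ij := mxtens_unindex (mxtens_index (i, J)).
by rewrite -[LHS]/(cons_tuple ij.1 (dec ij.2)) /ij mxtens_indexK.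
Qed.

Lemma encK q : cancel (@enc q) (@dec q).
Proof.
elim: q => [t|q IHq t]; first exact/esym/tuple0.
by rewrite dec_cons IHq [RHS]tuple_eta; apply: val_inj.
Qed.

Lemma decK q : cancel (@dec q) (@enc q).
Proof.
elim: q => [I|q IHq I]; first by rewrite [RHS]ord1.
case: (mxtens_indexP (I : 'I_(dimS X * dimS (powS q)))) => i J.
rewrite dec_cons; transitivity (mxtens_index (i, enc (dec J))).
  by congr (mxtens_index (_, enc _)); apply: val_inj.
by rewrite IHq.
Qed.

(** [F] is kept abstract to cover both [betaS] and [taut g]. *)
Lemma powS_entry (R : comNzRingType) (F : forall Y : objS s, 'M[R]_(dimS Y)) q I J :
  F (unitS s) = 1%:M -> (forall Y Z, F (tensorS Y Z) = F Y *t F Z) ->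
  F (powS q) I J = \prod_(u <- zip (dec I) (dec J)) F X u.1 u.2.
Proof.
move=> F1 FT; elim: q I J => [|q IHq] I J.
  by rewrite [F _]F1 big_nil [I]ord1 [J]ord1 mxE.
case: (mxtens_indexP (I : 'I_(dimS X * dimS (powS q)))) => i I'.
case: (mxtens_indexP (J : 'I_(dimS X * dimS (powS q)))) => j J'.
by rewrite !dec_cons /= big_cons -IHq FT tensmxE.
Qed.

Definition shift q (I : 'I_(dimS (powS q))) := enc (rot_tuple 1 (dec I)).

Lemma shift_inj q : injective (@shift q).
Proof.
move=> I J /(can_inj (@encK q))/(congr1 val)/= /rot_inj/val_inj.
exact: (can_inj (@decK q)).
Qed.

Definition shift_perm q := perm (@shift_inj q).

Lemma shift_permX q : (shift_perm q ^+ q)%g = 1%g.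
Proof.
have shiftX m I : (m <= q)%N ->
    dec ((shift_perm q ^+ m)%g I) = rot m (dec I) :> seq _.
  elim: m => [|m IHm] mq; first by rewrite perm1 rot0.
  rewrite expgSr permM permE encK /= IHm 1?ltnW //.
  by rewrite [RHS]rotS ?size_tuple.
apply/permP => I; rewrite perm1; apply/(can_inj (@decK q))/val_inj.
by rewrite [LHS]shiftX // rot_oversize ?size_tuple.
Qed.

Definition diag q (i : 'I_(dimS X)) : 'I_(dimS (powS q)) := enc (nseq_tuple q i).

Lemma diag_inj q : (0 < q)%N -> injective (@diag q).
Proof.
by case: q => // q _ i j /(can_inj (@encK q.+1))/(congr1 val) [].
Qed.

Lemma shift_diag q i : shift_perm q (diag q i) = diag q i.
Proof.
rewrite permE /shift encK; congr enc; apply: val_inj => /=.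
by case: q => // q; rewrite /= rot1_cons; elim: q => //= q ->.
Qed.

Lemma shift_fixed q (I : 'I_(dimS (powS q))) : (0 < q)%N ->
  shift_perm q I = I -> exists i, I = diag q i.
Proof.
case: q I => // q I _; rewrite permE => /(congr1 (@dec q.+1)); rewrite encK => /rot_tuple_fixed[i e].
by exists i; apply: (can_inj (@decK q.+1)); rewrite encK.
Qed.

(** Shifting both multi-indices only reorders the factors of a commutative product. *)
Lemma shift_entry (R : comNzRingType) (F : forall Y : objS s, 'M[R]_(dimS Y)) q I J :
  F (unitS s) = 1%:M -> (forall Y Z, F (tensorS Y Z) = F Y *t F Z) ->
  F (powS q) (shift_perm q I) (shift_perm q J) = F (powS q) I J.
Proof.
move=> F1 FT; rewrite !powS_entry // !permE !encK /=.
case: q I J => [|q] I J /=; first by rewrite !big_nil.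
rewrite !rot1_cons zip_rcons ?size_tuple //.
by rewrite (perm_big _ (permEl (perm_rcons _ _))).
Qed.


Lemma diag_entry (R : comNzRingType) (F : forall Y : objS s, 'M[R]_(dimS Y)) q i j :
  F (unitS s) = 1%:M -> (forall Y Z, F (tensorS Y Z) = F Y *t F Z) ->
  F (powS q) (diag q i) (diag q j) = F X i j ^+ q.
Proof.
move=> F1 FT; rewrite powS_entry // !encK /=.
by elim: q => [|q IHq]; rewrite ?big_nil //= big_cons IHq exprS.
Qed.

Lemma shift_hom q : homS (X := powS q) (Y := powS q) (perm_mx (shift_perm q)).
Proof.
rewrite /homS map_perm_mx -row_permE -[shift_perm q]invgK -col_permE invgK.
apply/matrixP => I J; rewrite !mxE.
by rewrite -[in RHS](shift_entry (F := @betaS _ _ s)) ?permKV //.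
Qed.

End TensorPowers.

(** * Upper bound on the height *)

Section Height.
Variables (k : fieldType) (A : comAlgType k) (s : {lrmorphism A -> k^o}).
Variables (p : nat) (char_k : p \in [pchar k]).

Lemma exprD_pchar_alg (R : comAlgType k) h (x y : R) :
  (x + y) ^+ (p ^ h) = x ^+ (p ^ h) + y ^+ (p ^ h).
Proof.
have p_pr := pcharf_prime char_k.
by apply: exprDn_pchar; rewrite pnatX pnatE // pchar_lalg char_k.
Qed.

Section FrobeniusKernel.
Variables (h : nat) (kernel_pow : forall a, s a = 0 -> a ^+ (p ^ h) = 0).
Let q := (p ^ h)%N.

Lemma q_gt0 : (0 < q)%N.
Proof. by rewrite expn_gt0 prime_gt0 // (pcharf_prime char_k). Qed.

(** By [betaS_point], [betaS X] differs from the identity by entries in the kernel of [s]. *)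
Lemma betaS_pow (X : objS s) i j : betaS X i j ^+ q = (i == j)%:R.
Proof.
rewrite -[betaS X i j](subrK (i == j)%:R) exprD_pchar_alg kernel_pow.
  by rewrite add0r; case: (i == j); rewrite ?expr1n // expr0n eqn0Ngt q_gt0.
rewrite rmorphB rmorph_nat /=; have /matrixP/(_ i j) := betaS_point X.
by rewrite !mxE => ->; rewrite subrr.
Qed.

(* Only the diagonal multi-indices are fixed by the shift, and on those
   [betaS] is the identity after raising its entries to the power [q]. *)
Lemma row_diag_betaS (X : objS s) (i : 'I_(dimS X)) m (v : 'M[A]_(dimS (powS X q), m)) :
  perm_mx (shift_perm X q) *m v = v ->
  row (diag q i) (betaS (powS X q) *m v) = row (diag q i) v.
Proof.
rewrite -row_permE => /matrixP vP; apply/matrixP => z j; rewrite !mxE {z}.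
have beta1 : betaS (unitS s) = 1%:M by [].
have betaT (Y Z : objS s) : betaS (tensorS Y Z) = betaS Y *t betaS Z by [].
have vS J : v (shift_perm X q J) j = v J j by rewrite -[RHS]vP mxE.
rewrite (bigD1 (diag q i)) //= diag_entry // betaS_pow eqxx mul1r.
rewrite -[RHS]addr0; congr (_ + _).
have char_A : p \in [pchar A] by rewrite pchar_lalg.
(* The excluded index becomes a zero term, so the sum runs over a shift-stable set. *)
rewrite big_mkcond; apply: (sum_perm_pchar char_A (shift_permX X (p ^ h))) => J.
  have -> : (shift_perm X q J == diag q i) = (J == diag q i).
    by rewrite -{1}(shift_diag q i) (inj_eq perm_inj).
  by rewrite vS -[in betaS _ (diag q i) _](shift_diag q i) shift_entry.
move=> /(shift_fixed q_gt0)[l ->]; case: ifP => // /eqP neJ.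
rewrite diag_entry // betaS_pow; case: eqP => [il|]; last by rewrite mul0r.
by case: neJ; rewrite il.
Qed.

Lemma taut_pow (R : comAlgType k) (g : tens_aut s R) (X : objS s) i j :
  taut g X i j ^+ q = (i == j)%:R.
Proof.
pose P : 'M[k]_(dimS (powS X q)) := perm_mx (shift_perm X q).
have shiftC : homS (X := powS X q) (Y := powS X q) (P - 1%:M).
  rewrite /homS map_mxB map_mx1 mulmxBl mulmxBr mul1mx mulmx1.
  by congr (_ - _); apply: shift_hom.
have [K [iota [iotaC Ciota Cuniv]]] := kernelS shiftC.
have [z zE] : exists z, delta_mx (diag q j) 0 = iota *m z :> 'cV[k]_ _.
  apply: Cuniv; rewrite mulmxBl mul1mx -row_permE; apply/eqP; rewrite subr_eq0.
  apply/eqP/matrixP => I l; rewrite !mxE ord1.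
  by rewrite -{1}(shift_diag q j) (inj_eq perm_inj).
have diagC : homS (X := K) (Y := unitS s) (row (diag q i) iota).
  rewrite /homS mul1mx map_row -row_mul [_ *m betaS K]iotaC row_diag_betaS //.
  apply/eqP; rewrite -subr_eq0 -{2}[map_mx _ iota]mul1mx -mulmxBl.
  rewrite -(map_perm_mx (in_alg A)) -(map_mx1 (in_alg A)) -map_mxB -map_mxM.
  by rewrite Ciota map_mx0.
(* Both naturalities say that [taut g] on the tensor power fixes row [diag q i] of [iota]; applying
   this to [z] isolates one diagonal entry. *)
have := taut_nat g diagC; rewrite taut_unit mul1mx map_row -row_mul.
rewrite [_ *m taut g K](taut_nat g iotaC) => /(congr1 (mulmx^~ (map_mx (in_alg R) z))).
rewrite -!row_mul -mulmxA -map_mxM -zE => /matrixP/(_ 0 0).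
rewrite map_delta_mx -colE !mxE andbT (inj_eq (diag_inj q_gt0)) => <-.
by rewrite (diag_entry (F := taut g)) ?taut_unit //; apply: taut_tensor.
Qed.

(** The [q]-th power is a ring morphism, so entries suffice; those of [tautV] are entries at the
    inverse point. *)
Lemma seval_pow (R : comAlgType k) (g : tens_aut s R) (t : sterm s) :
  seval g t ^+ q = (seval (tens_aut_one s k^o) t : k)%:A ^+ q.
Proof.
have entry (g' : tens_aut s R) (X : objS s) (i j : 'I_(dimS X)) :
    taut g' X i j ^+ q = ((1%:M : 'M[k]_(dimS X)) i j)%:A ^+ q.
  rewrite taut_pow mxE; case: (i == j); rewrite ?scale1r ?expr1n //.
  by rewrite scale0r expr0n eqn0Ngt q_gt0.
elim: t => /= [c|X i j|X i j|t IHt u IHu|t IHt u IHu].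
- by rewrite -[c%:A in RHS]/(c * 1) mulr1.
- exact: entry.
- exact: (entry (tens_aut_inv g)).
- by rewrite exprD_pchar_alg IHt IHu scalerDl exprD_pchar_alg.
- by rewrite exprMn IHt IHu -exprMn -scalerAl mul1r scalerA.
Qed.

Lemma annihilated_by_Fr_Sigma : annihilated_by_Fr (Sigma s) p h.
Proof.
move=> f f0; apply: sring_ext => R g.
rewrite rmorphXn rmorph0 [LHS]seval_pow.
have -> : seval (tens_aut_one s k^o) (repr f) = 0 by exact: f0.
by rewrite scale0r expr0n eqn0Ngt q_gt0.
Qed.

End FrobeniusKernel.

(** * Lower bound on the height *)

Definition beta_point : tens_aut s A :=
  @TensAut _ _ s A (@betaS _ _ s) (fun X => sval (cid (betaS_aut X)))
    (fun X => (svalP (cid (betaS_aut X))).2)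
    (fun X => (svalP (cid (betaS_aut X))).1)
    (fun X Y f fXY => fXY) erefl (fun X Y => erefl).

(* The value of [beta_point] at the object [(k, 1 + a)] detects [a]. *)
Lemma annihilated_by_Fr_kernel h a n : s a = 0 -> a ^+ n = 0 ->
  annihilated_by_Fr (Sigma s) p h -> a ^+ (p ^ h) = 0.
Proof.
move=> sa an annih.
have [b ab] : exists b, (1 + a) * b = 1.
  (* The geometric series of [- a], which stops as [a ^+ n = 0]. *)
  exists (\sum_(i < n) (- a) ^+ i).
  rewrite -[LHS]opprK -mulNr opprD [- 1 - a]addrC -subrX1 exprNn an.
  by rewrite mulr0 sub0r opprK.
have X_aut : exists B, (1 + a)%:M *m B = 1%:M :> 'M_1 /\ B *m (1 + a)%:M = 1%:M.
  exists b%:M; split; first by rewrite -scalar_mxM ab.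
  by rewrite -scalar_mxM mulrC ab.
have X_point : map_mx s (1 + a)%:M = 1%:M :> 'M_1.
  by rewrite map_scalar_mx rmorphD rmorph1 /= sa addr0.
pose X := ObjS X_aut X_point.
pose f : sring s := (\pi_(sring s)%qT (SEntry (X := X) ord0 ord0)) - 1.
have fE (R : comAlgType k) (g' : tens_aut s R) :
    sring_val g' f = taut g' X ord0 ord0 - 1.
  by rewrite rmorphB rmorph1 /= sring_val_pi.
have /(congr1 (sring_val beta_point)) : f ^+ (p ^ h) = 0.
  by apply: annih; rewrite /augmentation_ideal /= /counit /= fE /= mxE eqxx subrr.
by rewrite rmorphXn rmorph0 /= fE /= mxE eqxx mulr1n addrC addKr.
Qed.

End Height.

(* D = Spec A; as D is finite and connected and k is algebraically closed, the
   k-point s exists and is unique. *)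
Theorem proposition6p2 (k : closedFieldType) (p : nat) (char_k : p \in [pchar k])
    (A : comAlgType k) (A_finite : finite_algebra A)
    (D_connected : connected [set: Spec A]) (s : {lrmorphism A -> k^o}) :
  local_group_scheme (Sigma s) /\
  forall (m : {pred A}) (h : nat), maximal_ideal m -> (1 <= h)%N ->
    frobenius_power (p ^ h) m = [set 0] ->
    frobenius_power (p ^ h.-1) m <> [set 0] ->
    annihilated_by_Fr (Sigma s) p h /\ ~ annihilated_by_Fr (Sigma s) p h.-1.
Proof.
have p_gt1 := prime_gt1 (pcharf_prime char_k).
have [n nil] := nilpotent_kernel s A_finite D_connected.
have ker_nil a : s a = 0 -> exists n, a ^+ n = 0 by move=> /nil; exists n.
split.
  (* Since [n < p ^ n], the crude exponent [n] already makes the kernel of the counit nil. *)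
  have ann : annihilated_by_Fr (Sigma s) p n.
    apply: annihilated_by_Fr_Sigma => // a /nil an.
    by rewrite -(subnK (ltnW (ltn_expl n p_gt1))) exprD an mulr0.
  apply: (@unique_closed_point _ _ (counit (Sigma s))) => f /ann fn.
  by exists (p ^ n)%N.
move=> m h m_max _ mh mh1; have mE := maximal_ideal_kernel ker_nil m_max; split.
  apply: annihilated_by_Fr_Sigma => // a sa.
  suff : frobenius_power (p ^ h) m (a ^+ (p ^ h)) by rewrite mh.
  exists 1%N, (fun=> 1), (fun=> a ^+ (p ^ h)); rewrite big_ord1 mul1r; split=> // _.
  by exists a => //=; rewrite mE sa.
move=> ann; apply: mh1; apply/seteqP; split=> [_ [r [c [e [eP ->]]]]|_ ->].
  rewrite /= big1 // => i _; have [a /= am <-] := eP i.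
  have sa : s a = 0 by apply/eqP; rewrite -mE.
  by rewrite (annihilated_by_Fr_kernel sa (nil a sa) ann) mulr0.
by exists 0%N, (fun=> 0), (fun=> 0); rewrite big_ord0; split=> // -[].
Qed.
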